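(* There is an algorithm that, given an abstract network $(E, \mathcal{P})$ via a membership oracle and a vector $\gamma \in \mathbb{R}_+^E$, computes $P \in \mathcal{P}$ minimizing $\sum_{e \in P} \gamma_e$ in time $\mathcal{O}(|E|^2 \cdot T_{\mathcal{P}})$, where $T_{\mathcal{P}}$ denotes the time for one call to the membership oracle for $\mathcal{P}$.
   Context: An abstract network is a pair $(E,\mathcal{P})$ with $E$ a finite set (given explicitly) and $\mathcal{P} \subseteq 2^E$, where each $P \in \mathcal{P}$ carries a linear order $\preceq_P$ of its elements, such that for all $P, Q \in \mathcal{P}$ and all $e \in P \cap Q$ there exists $R \in \mathcal{P}$ with $R \subseteq \{p \in P : p \preceq_P e\} \cup \{q \in Q : e \preceq_Q q\}$. A membership oracle for $\mathcal{P}$, given $F \subseteq E$, either returns some $P \in \mathcal{P}$ with $P \subseteq F$ together with its order $\preceq_P$, or certifies that no such $P$ exists. *)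

(* Defs.v *)
From mathcomp Require Import all_boot all_order all_algebra.
From mathcomp Require Import reals.

Set Implicit Arguments.
Unset Strict Implicit.
Unset Printing Implicit Defensive.


(* [path_le P] is only meaningful, and only constrained, on the elements of a
   member [P] of [paths]. *)
Record abstract_network (E : finType) := AbstractNetwork {
  paths : {set {set E}};
  path_le : {set E} -> rel E;
  path_le_refl : forall P, P \in paths -> {in P, reflexive (path_le P)};
  path_le_anti : forall P, P \in paths -> {in P &, antisymmetric (path_le P)};
  path_le_trans : forall P, P \in paths -> {in P & &, transitive (path_le P)};
  path_le_total : forall P, P \in paths -> {in P &, total (path_le P)};
  path_switch : forall (P Q : {set E}) (e : E),
    P \in paths -> Q \in paths -> e \in P -> e \in Q ->
    exists2 R, R \in paths &
      R \subset [set p in P | path_le P p e] :|: [set q in Q | path_le Q e q]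
}.

Definition min_weight_path (R : realType) (E : finType)
    (N : abstract_network E) (gamma : E -> R) (P : {set E}) : Prop :=
  P \in paths N /\
  forall Q, Q \in paths N ->
    (\sum_(e in P) gamma e <= \sum_(e in Q) gamma e)%R.

Definition enumerates (E : finType) (P : {set E}) (s : seq E) : Prop :=
  uniq s /\ s =i P.

(* A path is returned together with its order by listing its elements in
   increasing order. *)
Definition membership_oracle (E : finType) (N : abstract_network E)
    (O : {set E} -> option (seq E)) : Prop :=
  forall F : {set E},
    match O F with
    | Some s => exists P : {set E},
        [/\ P \in paths N, P \subset F, enumerates P s & sorted (path_le N P) s]
    | None => forall P, P \in paths N -> ~~ (P \subset F)
    end.

(* The memory consists of arrays of natural numbers and arrays of reals. Array
   names are constants of the program, whereas indices are computed; a scalar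
   variable is cell 0 of an array. Arithmetic is additive: there is neither
   multiplication nor rounding, and 0 is the only real constant, so that unit
   costs are not abused and programs do not depend on the field of reals. *)
Inductive nexp :=
  | NConst of nat
  | NGet of nat & nexp
  | NAdd of nexp & nexp
  | NSub of nexp & nexp.

Inductive rexp :=
  | RZero
  | RGet of nat & nexp
  | RAdd of rexp & rexp
  | RSub of rexp & rexp.

Inductive bexp :=
  | NLe of nexp & nexp
  | RLe of rexp & rexp
  | BNot of bexp
  | BAnd of bexp & bexp.

Inductive cmd :=
  | Skip
  | NSet of nat & nexp & nexp  (* array, index, value *)
  | RSet of nat & nexp & rexp  (* array, index, value *)
  | Query of nat & nat         (* array with the query, array for the answer *)
  | Seq of cmd & cmd
  | If of bexp & cmd & cmd
  | While of bexp & cmd.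

Record state (R : realType) := State {
  nats : nat -> nat -> nat;
  rls : nat -> nat -> R
}.

Definition update (T : Type) (m : nat -> nat -> T) (a i : nat) (v : T) :=
  fun b j => if (b == a) && (j == i) then v else m b j.

Fixpoint neval (R : realType) (st : state R) (x : nexp) : nat :=
  match x with
  | NConst n => n
  | NGet a i => nats st a (neval st i)
  | NAdd x1 x2 => neval st x1 + neval st x2
  | NSub x1 x2 => neval st x1 - neval st x2
  end.

Fixpoint reval (R : realType) (st : state R) (x : rexp) : R :=
  match x with
  | RZero => 0%R
  | RGet a i => rls st a (neval st i)
  | RAdd x1 x2 => (reval st x1 + reval st x2)%R
  | RSub x1 x2 => (reval st x1 - reval st x2)%R
  end.

Fixpoint beval (R : realType) (st : state R) (x : bexp) : bool :=
  match x with
  | NLe x1 x2 => neval st x1 <= neval st x2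
  | RLe x1 x2 => (reval st x1 <= reval st x2)%R
  | BNot b => ~~ beval st b
  | BAnd b1 b2 => beval st b1 && beval st b2
  end.

(* The ground set is given explicitly: the element [e] is represented by its
   index [enum_rank e] in the enumeration of [E]. *)
Definition query_set (E : finType) (m : nat -> nat) : {set E} :=
  [set e : E | m (enum_rank e) != 0].

Definition encode_answer (E : finType) (o : option (seq E)) : seq nat :=
  match o with
  | Some s => (size s).+1 :: [seq nat_of_ord (enum_rank e) | e <- s]
  | None => [:: 0]
  end.

Definition write_seq (m : nat -> nat -> nat) (a : nat) (w : seq nat) :=
  fun b j => if b == a then nth (m b j) w j else m b j.

(* [exec O T c st st' t]: started in [st], the command [c] halts in [st'] after
   time [t], where a call to the oracle [O] takes time [T]. The expressions in
   a program have constant size, hence each assignment or test takes time 1. *)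
Inductive exec (R : realType) (E : finType) (O : {set E} -> option (seq E))
    (T : nat) : cmd -> state R -> state R -> nat -> Prop :=
  | exec_skip st : exec O T Skip st st 1
  | exec_nset a i x st :
      exec O T (NSet a i x) st
        (State (update (nats st) a (neval st i) (neval st x)) (rls st)) 1
  | exec_rset a i x st :
      exec O T (RSet a i x) st
        (State (nats st) (update (rls st) a (neval st i) (reval st x))) 1
  | exec_query q a st :
      exec O T (Query q a) st
        (State (write_seq (nats st) a
                  (encode_answer (O (query_set E (nats st q))))) (rls st)) T
  | exec_seq c1 c2 st1 st2 st3 t1 t2 :
      exec O T c1 st1 st2 t1 -> exec O T c2 st2 st3 t2 ->
      exec O T (Seq c1 c2) st1 st3 (t1 + t2)
  | exec_if b c1 c2 st st' t :
      exec O T (if beval st b then c1 else c2) st st' t ->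
      exec O T (If b c1 c2) st st' t.+1
  | exec_while_end b c st :
      ~~ beval st b -> exec O T (While b c) st st 1
  | exec_while_loop b c st1 st2 st3 t1 t2 :
      beval st1 b -> exec O T c st1 st2 t1 -> exec O T (While b c) st2 st3 t2 ->
      exec O T (While b c) st1 st3 (t1 + t2).+1.

Lemma exec_deterministic (R : realType) (E : finType)
    (O : {set E} -> option (seq E)) (T : nat) (c : cmd)
    (st st1 st2 : state R) (t1 t2 : nat) :
  exec O T c st st1 t1 -> exec O T c st st2 t2 -> st1 = st2 /\ t1 = t2.
Proof.
move=> H; elim: H st2 t2 => {c st st1 t1}.
- by move=> st st2 t2 H; inversion H.
- by move=> a i x st st2 t2 H; inversion H.
- by move=> a i x st st2 t2 H; inversion H.
- by move=> q a st st2 t2 H; inversion H.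
- move=> c1 c2 s1 s2 s3 t1 t2 _ IH1 _ IH2 st t H.
  inversion H as [| | | | ? ? ? ? ? ? ? K1 K2 | | |]; subst.
  by case: (IH1 _ _ K1) => ? ?; subst; case: (IH2 _ _ K2) => ? ?; subst.
- move=> b c1 c2 st st' t _ IH st2 t2 H.
  inversion H as [| | | | | ? ? ? ? ? ? K | |]; subst.
  by case: (IH _ _ K) => ? ?; subst.
- move=> b c st Hb st2 t2 H.
  inversion H as [| | | | | | | ? ? ? ? ? ? ? K]; subst => //.
  by rewrite K in Hb.
- move=> b c s1 s2 s3 t1 t2 Hb _ IH1 _ IH2 st t H.
  inversion H as [| | | | | | ? ? ? K | ? ? ? ? ? ? ? _ K1 K2]; subst.
    by rewrite Hb in K.
  by case: (IH1 _ _ K1) => ? ?; subst; case: (IH2 _ _ K2) => ? ?; subst.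
Qed.

(* Input: |E| in cell 0 of array 0 of naturals, gamma in array 0 of reals; all
   other cells are 0. *)
Definition initial_state (R : realType) (E : finType) (gamma : E -> R) :
    state R :=
  State (update (fun _ _ => 0) 0 0 #|E|)
        (fun a i => if a == 0 then nth 0%R [seq gamma e | e <- enum E] i else 0%R).

(* Output: array 1 of naturals, in the format of the oracle answers. *)
Definition outputs (R : realType) (E : finType) (st : state R)
    (o : option (seq E)) : Prop :=
  forall i, i < size (encode_answer o) ->
    nats st 1 i = nth 0 (encode_answer o) i.

(* If there is no path at all, then there is no minimizer and the program has
   to report this. *)
Definition solves_min_path (R : realType) (E : finType)
    (N : abstract_network E) (gamma : E -> R) (o : option (seq E)) : Prop :=
  match o with
  | Some s => exists2 P, min_weight_path N gamma P & enumerates P s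
  | None => paths N = set0
  end.

(* Main.v *)
Require Import Defs.
From mathcomp Require Import all_boot all_order all_algebra.
From mathcomp Require Import reals zify lra.

(* The program packs cuts into [gamma] greedily, as Dijkstra's algorithm does. It
   maintains a frontier [C] and a set [Z] of elements that have left it. A query
   with the complement of [C] either returns a path, whose first element outside
   [Z] then enters [C] together with the prefix of the path that ends there, or
   shows that [C] is a cut. In the latter case the cut receives the largest weight
   that the remaining capacities allow, and an element that is exhausted moves
   from [C] to [Z]. This stops after at most [2 |E| + 1] queries, when a path
   inside [Z] is found.

   All elements of that path are exhausted, so it is optimal if it crosses every
   cut exactly once. To achieve this, treat the cuts from the last to the first:
   switch, at the last element [e] of the path in the cut, to the stored prefix
   of [e]. Since this prefix had left the frontier before [e] entered it, it
   contains no element other than [e] of this cut or of a later one. *)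

Set Implicit Arguments.
Unset Strict Implicit.
Unset Printing Implicit Defensive.
Import Order.TTheory GRing.Theory Num.Theory.

(** * Paths as lists, and switching between them *)

Definition listed_path (E : finType) (N : abstract_network E) (s : seq E) :=
  exists2 P : {set E}, P \in paths N & enumerates P s /\ sorted (Defs.path_le N P) s.

Lemma path_le_index (E : finType) (N : abstract_network E) (P : {set E})
    (s : seq E) (x y : E) :
  P \in paths N -> enumerates P s -> sorted (Defs.path_le N P) s ->
  x \in P -> y \in P -> Defs.path_le N P x y -> index x s <= index y s.
Proof.
move=> PN [us sP] ss xP yP lexy; rewrite leqNgt; apply/negP => lt_yx.
have xs : x \in s by rewrite sP.
have ys : y \in s by rewrite sP.
have leyx : Defs.path_le N P y x.
  have al : all (mem P) s by apply/allP => z; rewrite sP.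
  have := sorted_ltn_nth_in (path_le_trans PN) x al ss.
  move=> /(_ (index y s) (index x s)); rewrite !inE !index_mem => /(_ ys xs lt_yx).
  by rewrite !nth_index.
have xy : x = y by apply: (path_le_anti PN) => //; rewrite lexy.
by rewrite xy ltnn in lt_yx.
Qed.

(** Puts the switching axiom in terms of positions in the lists, which is all that the program sees
    of the orders. *)
Lemma listed_path_switch (E : finType) (N : abstract_network E)
    (s u : seq E) (e : E) :
  listed_path N s -> listed_path N u -> e \in s -> e \in u ->
  exists2 Q, Q \in paths N & forall x, x \in Q ->
    (x \in s) && (index x s <= index e s) || (x \in u) && (index e u <= index x u).
Proof.
move=> [P PN [sP ss]] [Q QN [uQ su]] es eu.
have eP : e \in P by rewrite -(proj2 sP).
have eQ : e \in Q by rewrite -(proj2 uQ).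
have [S SN subS] := path_switch PN QN eP eQ; exists S => // x /(subsetP subS).
rewrite !inE => /orP[]/andP[xP lex]; apply/orP; [left|right].
  by rewrite (proj2 sP) xP (path_le_index PN sP ss xP eP).
by rewrite (proj2 uQ) xP (path_le_index QN uQ su eQ xP).
Qed.

(** * Packings of cuts and optimality *)

(* The element [e] is on the frontier from round [lo e] to round [hi e]; the
   value 0 means that it has not yet entered, respectively left, the frontier. *)
Definition in_cut (E : finType) (lo hi : E -> nat) (i : nat) (e : E) :=
  [&& 0 < lo e, lo e <= i & (hi e == 0) || (i <= hi e)].

(** The capacity of [e] that the cuts leave over. All frontier elements lose capacity at the same
    rate, so [D e] is the value of [tau] at which [e] is exhausted and stays fixed while [tau]
    grows. *)
Definition residual (R : realType) (E : finType) (gamma D : E -> R)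
    (lo hi : E -> nat) (tau : R) (e : E) : R :=
  (if lo e == 0%N then gamma e else if hi e == 0%N then D e - tau else 0)%R.

(* State after [K] rounds: the cuts [in_cut lo hi i] with weights [eps i] form a
   packing below [gamma], and [A e] is a prefix of a path ending with [e]. *)
Record packing (R : realType) (E : finType) (N : abstract_network E)
    (gamma : E -> R) (lo hi : E -> nat) (A : E -> {set E}) (D : E -> R)
    (K : nat) (tau : R) (eps : nat -> R) : Prop := Packing {
  pack_lo : forall e, lo e <= K.+1;
  pack_hi : forall e, hi e <= K;
  pack_lohi : forall e, 0 < hi e -> 0 < lo e;
  pack_card : K = #|[set e | 0 < hi e]|;
  pack_cut : forall i P, 0 < i <= K -> P \in paths N ->
    exists2 e, e \in P & in_cut lo hi i e;
  pack_prefix : forall e u, 0 < lo e -> listed_path N u -> e \in u ->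
    exists2 Q, Q \in paths N & forall x, x \in Q ->
      (x \in A e) || (x \in u) && (index e u <= index x u);
  pack_before : forall e f, 0 < lo e -> f \in A e -> f != e -> 0 < hi f < lo e;
  pack_eps : forall i, (0 <= eps i)%R;
  pack_residual : forall e, (0 <= residual gamma D lo hi tau e)%R;
  pack_weight : forall e, gamma e = (residual gamma D lo hi tau e +
    \sum_(1 <= i < K.+1) (if in_cut lo hi i e then eps i else 0))%R
}.

Lemma packing0 (R : realType) (E : finType) (N : abstract_network E)
    (gamma D : E -> R) (A : E -> {set E}) :
  (forall e, 0 <= gamma e)%R ->
  packing N gamma (fun=> 0) (fun=> 0) A D 0 0%R (fun=> 0%R).
Proof.
move=> gamma_ge0; split => //=.
- by rewrite (_ : [set _ | _] = set0) ?cards0 //; apply/setP => e; rewrite !inE.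
- by case.
- by move=> e; rewrite big_geq // addr0.
Qed.

Definition upd (E : finType) (T : Type) (f : E -> T) (m : E) (v : T) (e : E) :=
  if e == m then v else f e.

(** The new element belongs only to cuts after round [K], so the existing cuts do not change; the
    choice of [D e] keeps its residual at [gamma e]. *)
Lemma packing_enter (R : realType) (E : finType) (N : abstract_network E)
    (gamma : E -> R) (lo hi : E -> nat) (A : E -> {set E}) (D : E -> R)
    (K : nat) (tau : R) (eps : nat -> R) (s : seq E) (e : E) (B : {set E}) :
  (forall e, 0 <= gamma e)%R ->
  packing N gamma lo hi A D K tau eps ->
  listed_path N s -> e \in s -> lo e = 0 -> hi e = 0 ->
  (forall x, x \in s -> index x s < index e s -> 0 < hi x) ->
  (forall x, (x \in B) = (x \in s) && (index x s <= index e s)) ->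
  packing N gamma (upd lo e K.+1) hi (upd A e B)
    (upd D e (tau + gamma e)%R) K tau eps.
Proof.
move=> gamma_ge0 [Hlo Hhi Hlohi Hcard Hcut Hpre Hbef Heps Hres Hw] ls es lo0 hi0 Hs HB.
have cutE i x : i <= K -> in_cut (upd lo e K.+1) hi i x = in_cut lo hi i x.
  move=> leiK; rewrite /in_cut /upd; case: eqP => // ->.
  by rewrite lo0 [K < i]ltnNge leiK.
have resE x : residual gamma (upd D e (tau + gamma e)%R) (upd lo e K.+1) hi tau x
    = residual gamma D lo hi tau x.
  by rewrite /residual /upd; case: (x =P e) => // ->; rewrite lo0 hi0 /= addrC addKr.
split => //.
- by move=> x; rewrite /upd; case: ifP.
- by move=> x; rewrite /upd; case: ifP => // _; apply: Hlohi.
- move=> i P iK PN; have [x xP xi] := Hcut i P iK PN; exists x => //.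
  by rewrite cutE //; case/andP: iK.
(* For [e] itself the stored prefix is the part of [s] up to [e], and switching from [s] to [u] at
   [e] gives the path. *)
- move=> x u; rewrite /upd; case: eqP => [->|_]; last exact: Hpre.
  move=> _ lu eu; have [Q QN HQ] := listed_path_switch ls lu es eu.
  by exists Q => // y /HQ; rewrite HB.
- move=> x f; rewrite /upd; case: eqP => [->|_]; last exact: Hbef.
  move=> _; rewrite HB => /andP[fs lef] nfe; rewrite ltnS Hhi andbT Hs //.
  rewrite ltn_neqAle lef andbT; apply: contra nfe => /eqP eqi.
  by rewrite -(nth_index e fs) eqi nth_index.
- by move=> x; rewrite resE.
- move=> x; rewrite resE [LHS]Hw; congr (_ + _)%R.
  by apply: eq_big_nat => i /andP[_ lei]; rewrite cutE.
Qed.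

(** The frontier becomes cut [K.+1], with the smallest residual on it, that of [m], as its weight.
    Raising the total to [D m] exhausts [m] and lowers the other frontier residuals by the same
    amount. *)
Lemma packing_pop (R : realType) (E : finType) (N : abstract_network E)
    (gamma : E -> R) (lo hi : E -> nat) (A : E -> {set E}) (D : E -> R)
    (K : nat) (tau : R) (eps : nat -> R) (m : E) :
  packing N gamma lo hi A D K tau eps ->
  (forall P, P \in paths N -> exists2 e, e \in P & (0 < lo e) && (hi e == 0)) ->
  0 < lo m -> hi m = 0 ->
  (forall e, 0 < lo e -> hi e = 0 -> (D m <= D e)%R) ->
  exists eps', packing N gamma lo (upd hi m K.+1) A D K.+1 (D m) eps'.
Proof.
move=> [Hlo Hhi Hlohi Hcard Hcut Hpre Hbef Heps Hres Hw] Hall lom him Hmin.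
exists (fun i => if i == K.+1 then D m - tau else eps i)%R.
have cutE i x : i <= K -> in_cut lo (upd hi m K.+1) i x = in_cut lo hi i x.
  move=> leiK; rewrite /in_cut /upd; case: (x =P m) => // ->.
  by rewrite him /= (leqW leiK).
have cutK x : in_cut lo (upd hi m K.+1) K.+1 x = (0 < lo x) && (hi x == 0).
  rewrite /in_cut /upd Hlo; case: (x =P m) => [->|_];
    first by rewrite him lom leqnn orbT.
  by rewrite [K < _]ltnNge Hhi orbF.
split => //.
- by move=> e; apply: leqW.
- by move=> e; rewrite /upd; case: ifP => // _; apply: leqW.
- by move=> e; rewrite /upd; case: eqP => [->|_] //; apply: Hlohi.
- rewrite (_ : [set _ | _] = m |: [set e | 0 < hi e]).
    by rewrite cardsU1 inE him -Hcard.
  by apply/setP => e; rewrite !inE /upd; case: eqP.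
- move=> i P /andP[i0]; rewrite leq_eqVlt => /orP[/eqP ->|leiK] PN.
    by have [e eP He] := Hall P PN; exists e; rewrite // cutK.
  have [|e eP He] := Hcut i P _ PN; first by rewrite i0.
  by exists e; rewrite // cutE.
- move=> e f lo0 fA nfe; rewrite /upd; case: (f =P m) => [fm|_]; last exact: Hbef.
  by have := Hbef e f lo0 fA nfe; rewrite fm him.
- move=> i; case: eqP => // _; have := Hres m.
  by rewrite /residual him eqxx -[_ == _]negbK -lt0n lom.
- move=> e; have := Hres e; rewrite /residual /upd; case: eqP => // /eqP.
  rewrite -lt0n => lo0; case: (e =P m) => // _; case: eqP => // hi0.
  by move=> _; rewrite subr_ge0; apply: Hmin.
- move=> e; rewrite big_nat_recr //= cutK eqxx.
  have -> : (\sum_(1 <= i < K.+1)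
     (if in_cut lo (upd hi m K.+1) i e then
        if i == K.+1 then D m - tau else eps i else 0) =
     \sum_(1 <= i < K.+1) (if in_cut lo hi i e then eps i else 0))%R.
    apply: eq_big_nat => i /andP[_ lei]; rewrite cutE //.
    by rewrite (ltn_eqF lei).
  rewrite [LHS]Hw; set S := (\sum_(_ <= _ < _) _)%R.
  (* The weight of the new cut is what the residuals of its elements lose; all other residuals
     stay. *)
  rewrite /residual /upd lt0n; case: (lo e =P 0) => [|lo0]; first by rewrite addr0.
  case: (e =P m) => [->|_]; first by rewrite him /=; lra.
  by case: (hi e =P 0) => _ /=; lra.
Qed.

(* Rerouting at the last element of [u] in cut [i] through the prefix [A e]
   adds no element of the cuts [j >= i], since [A e] left the frontier before. *)
Lemma packing_reroute (R : realType) (E : finType) (N : abstract_network E)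
    (gamma : E -> R) (lo hi : E -> nat) (A : E -> {set E}) (D : E -> R)
    (K : nat) (tau : R) (eps : nat -> R) (u : seq E) (i : nat) (e : E) (w : {set E}) :
  packing N gamma lo hi A D K tau eps ->
  e \in u -> in_cut lo hi i e -> {in u, forall x, 0 < hi x} ->
  {in u, forall x, in_cut lo hi i x -> index x u <= index e u} ->
  (forall j, i < j <= K -> {in u &, forall x y,
     in_cut lo hi j x -> in_cut lo hi j y -> x = y}) ->
  {in w, forall x, (x \in A e) || (x \in u) && (index e u <= index x u)} ->
  {in w, forall x, 0 < hi x} /\
  (forall j, i <= j <= K -> {in w &, forall x y,
     in_cut lo hi j x -> in_cut lo hi j y -> x = y}).
Proof.
move=> pk eu ei hiu last_e uniq_u sub_w.
have /and3P[lo0 loi _] := ei.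
have cut_u j x : i <= j -> x \in w -> in_cut lo hi j x ->
    x \in u /\ index e u <= index x u.
  move=> lij xw xj; have /orP[xA|/andP[]//] := sub_w x xw.
  have [->//|nxe] := eqVneq x e.
  (* An element of [A e] other than [e] left before [e] entered, which would give
     [hi x < lo e <= i <= j <= hi x]. *)
  have /andP[hx lx] := pack_before pk lo0 xA nxe.
  have /and3P[_ _] := xj; rewrite -[_ == 0]negbK -lt0n hx /= => ljx.
  by have := leq_ltn_trans (leq_trans lij ljx) (leq_trans lx loi); rewrite ltnn.
split=> [x xw|j /andP[lij jK] x y xw yw xj yj].
  have /orP[xA|/andP[/hiu//]] := sub_w x xw.
  have [->|nxe] := eqVneq x e; first exact: hiu.
  by case/andP: (pack_before pk lo0 xA nxe).
have [xu lex] := cut_u j x lij xw xj; have [yu ley] := cut_u j y lij yw yj.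
move: lij; rewrite leq_eqVlt => /orP[/eqP eij|lij]; last first.
  by apply: (uniq_u j); rewrite ?lij.
(* In cut [i] the elements of [w] lie at or after [e] on [u], where [e] is the last one of the
   cut. *)
have eqe z : z \in u -> index e u <= index z u -> in_cut lo hi j z -> z = e.
  rewrite -eij => zu lez zi; rewrite -(nth_index e zu) -[RHS](nth_index e eu).
  by congr nth; apply/eqP; rewrite eqn_leq lez last_e.
by rewrite (eqe x) // (eqe y).
Qed.

(** Weak duality, with the sum of the [eps i] between the two weights: [P] consists of exhausted
    elements and meets each cut once, while [Q] meets each cut at least once and residuals are
    nonnegative. *)
Lemma packing_optimal (R : realType) (E : finType) (N : abstract_network E)
    (gamma : E -> R) (lo hi : E -> nat) (A : E -> {set E}) (D : E -> R)
    (K : nat) (tau : R) (eps : nat -> R) (P : {set E}) :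
  packing N gamma lo hi A D K tau eps ->
  P \in paths N -> {in P, forall x, 0 < hi x} ->
  (forall j, 0 < j <= K -> {in P &, forall x y,
     in_cut lo hi j x -> in_cut lo hi j y -> x = y}) ->
  min_weight_path N gamma P.
Proof.
move=> pk PN hiP uniqP.
have weightE (Q : {set E}) : (\sum_(e in Q) gamma e =
    \sum_(e in Q) residual gamma D lo hi tau e +
    \sum_(1 <= i < K.+1) \sum_(e in Q) (if in_cut lo hi i e then eps i else 0))%R.
  by rewrite exchange_big -big_split; apply: eq_bigr => e _; apply: (pack_weight pk).
split=> // Q QN; apply: (@le_trans _ _ (\sum_(1 <= i < K.+1) eps i)%R).
  rewrite weightE big1 ?add0r => [|e eP]; last first.
    have hx := hiP e eP; have lx := pack_lohi pk hx.
    by rewrite /residual; move: hx lx; rewrite !lt0n => /negbTE -> /negbTE ->.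
  apply: ler_sum_nat => i iK.
  have [e eP ei] := pack_cut pk (i := i) iK PN.
  rewrite (bigD1 e) //= ei big1 ?addr0 // => x /andP[xP nxe].
  case: ifP => // xi; case/eqP: nxe; exact: (uniqP i iK).
rewrite weightE; apply: (@le_trans _ _ (\sum_(1 <= i < K.+1)
    \sum_(e in Q) (if in_cut lo hi i e then eps i else 0))%R).
  apply: ler_sum_nat => i iK.
  have [e eQ ei] := pack_cut pk (i := i) iK QN.
  rewrite (bigD1 e) //= ei lerDl sumr_ge0 // => x _.
  by case: ifP => // _; apply: (pack_eps pk).
by rewrite lerDr sumr_ge0 // => e _; apply: (pack_residual pk).
Qed.

(** * Timed executions of programs *)

(** A total correctness triple with a time bound. Since the postcondition is a predicate on states,
    a run of the next command can serve as postcondition of the previous one. *)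
Definition run (R : realType) (E : finType) (O : {set E} -> option (seq E))
    (T : nat) (c : cmd) (st : state R) (k : nat) (Q : state R -> Prop) : Prop :=
  exists st' t, [/\ exec O T c st st' t, t <= k & Q st'].

Definition set_nat (R : realType) (st : state R) (a i v : nat) : state R :=
  State (update (nats st) a i v) (rls st).

Lemma run_mono (R : realType) (E : finType) (O : {set E} -> option (seq E))
    (T : nat) (c : cmd) (st : state R) (k k' : nat) (Q Q' : state R -> Prop) :
  run O T c st k Q -> k <= k' -> (forall st', Q st' -> Q' st') ->
  run O T c st k' Q'.
Proof.
move=> [st' [t [ex le_tk HQ]]] le_kk' QQ'; exists st', t; split=> //.
  exact: leq_trans le_kk'.
exact: QQ'.
Qed.

Lemma run_skip (R : realType) (E : finType) (O : {set E} -> option (seq E))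
    (T : nat) (st : state R) (k : nat) (Q : state R -> Prop) :
  0 < k -> Q st -> run O T Skip st k Q.
Proof. by move=> k0 HQ; exists st, 1; split=> //; constructor. Qed.

Lemma run_nset (R : realType) (E : finType) (O : {set E} -> option (seq E))
    (T a : nat) (i x : nexp) (st : state R) (k : nat) (Q : state R -> Prop) :
  0 < k -> Q (set_nat st a (neval st i) (neval st x)) ->
  run O T (NSet a i x) st k Q.
Proof. by move=> k0 HQ; eexists; exists 1; split=> //; first exact: exec_nset. Qed.

Lemma run_rset (R : realType) (E : finType) (O : {set E} -> option (seq E))
    (T a : nat) (i : nexp) (x : rexp) (st : state R) (k : nat)
    (Q : state R -> Prop) :
  0 < k ->
  Q (State (nats st) (update (rls st) a (neval st i) (reval st x))) ->
  run O T (RSet a i x) st k Q.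
Proof. by move=> k0 HQ; eexists; exists 1; split=> //; first exact: exec_rset. Qed.

Lemma run_seq (R : realType) (E : finType) (O : {set E} -> option (seq E))
    (T : nat) (c1 c2 : cmd) (st : state R) (k1 k2 k : nat)
    (Q : state R -> Prop) :
  run O T c1 st k1 (fun st' => run O T c2 st' k2 Q) -> k1 + k2 <= k ->
  run O T (Seq c1 c2) st k Q.
Proof.
move=> [st1 [t1 [ex1 le1 [st2 [t2 [ex2 le2 HQ]]]]]] le_k.
exists st2, (t1 + t2); split=> //; first exact: exec_seq ex1 ex2.
exact: leq_trans (leq_add le1 le2) le_k.
Qed.

Lemma run_if (R : realType) (E : finType) (O : {set E} -> option (seq E))
    (T : nat) (b : bexp) (c1 c2 : cmd) (st : state R) (k : nat)
    (Q : state R -> Prop) :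
  run O T (if beval st b then c1 else c2) st k Q ->
  run O T (If b c1 c2) st k.+1 Q.
Proof.
move=> [st' [t [ex le_tk HQ]]]; exists st', t.+1; split=> //.
exact: exec_if.
Qed.

Definition cell0 (v : nat) : nexp := NGet v (NConst 0).

Definition for_loop (v : nat) (b : nexp) (c : cmd) : cmd :=
  Seq (NSet v (NConst 0) (NConst 0))
    (While (BNot (NLe b (cell0 v)))
       (Seq c (NSet v (NConst 0) (NAdd (cell0 v) (NConst 1))))).

(** The body must establish the invariant for the state in which the counter is already increased.
    An iteration costs the body plus test and increment; the final [2] pays for the initialization
    and the last test. *)
Lemma run_for (R : realType) (E : finType) (O : {set E} -> option (seq E))
    (T v : nat) (b : nexp) (c : cmd) (st : state R) (n k : nat)
    (I : nat -> state R -> Prop) (Q : state R -> Prop) :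
  (forall i st', I i st' -> neval st' b = n) ->
  I 0 (set_nat st v 0 0) ->
  (forall i st', i < n -> nats st' v 0 = i -> I i st' ->
     run O T c st' k
       (fun st'' => nats st'' v 0 = i /\ I i.+1 (set_nat st'' v 0 i.+1))) ->
  (forall st', I n st' -> Q st') ->
  run O T (for_loop v b c) st (n * k.+2 + 2) Q.
Proof.
move=> Hb I0 Hc HQ.
apply: (@run_seq _ _ _ _ _ _ _ 1 (n * k.+2).+1); last by lia.
apply: run_nset => //=.
suff loop j i st' : i + j = n -> nats st' v 0 = i -> I i st' ->
    run O T (While (BNot (NLe b (cell0 v)))
       (Seq c (NSet v (NConst 0) (NAdd (cell0 v) (NConst 1))))) st'
      (j * k.+2).+1 Q.
  by apply: (loop n 0) => //=; rewrite /update !eqxx.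
elim: j i st' => [|j IH] i st' eij vi Ii.
  exists st', 1; split=> //; last by apply: HQ; rewrite -eij addn0.
  by apply: exec_while_end; rewrite /= vi (Hb _ _ Ii) negbK -eij addn0.
have lt_in : i < n by rewrite -eij addnS ltnS leq_addr.
have [st1 [t1 [ex1 le1 [v1 I1]]]] := Hc i st' lt_in vi Ii.
have [||st2 [t2 [ex2 le2 Q2]]] := IH i.+1 _ _ _ I1.
- by rewrite addSnnS.
- by rewrite /= /update !eqxx.
exists st2, ((t1 + 1) + t2).+1; split=> //.
  apply: exec_while_loop ex2; first by rewrite /= vi (Hb _ _ Ii) -ltnNge.
  apply: exec_seq ex1 _.
  have := exec_nset O T v (NConst 0) (NAdd (cell0 v) (NConst 1)) st1.
  by rewrite /= v1 addn1.
by rewrite mulSn; lia.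
Qed.

(** * Frames, oracle answers and ranks *)

(** The searching and copying subroutines write only to arrays of naturals; reals change in [pop]
    and [enter] alone, which are specified without frames. *)
Definition frame (R : realType) (l : seq nat) (st st' : state R) : Prop :=
  (forall a, a \notin l -> nats st' a =1 nats st a) /\ rls st' = rls st.

Lemma frame_set (R : realType) (l : seq nat) (st st' : state R) (a i v : nat) :
  a \in l -> frame l st st' -> frame l st (set_nat st' a i v).
Proof.
move=> al [fn fr]; split=> // b bl j; rewrite /= /update.
by case: eqP bl al => [-> /negbTE ->|_ bl _] //=; apply: fn.
Qed.

Lemma frame_trans (R : realType) (l l' : seq nat) (st1 st2 st3 : state R) :
  frame l st1 st2 -> frame l' st2 st3 -> frame (l ++ l') st1 st3.
Proof.
move=> [fn fr] [fn' fr']; split=> [a|]; last by rewrite fr'.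
by rewrite mem_cat negb_or => /andP[al al'] j; rewrite fn' ?fn.
Qed.

Lemma run_query (R : realType) (E : finType) (O : {set E} -> option (seq E))
    (T q : nat) (st : state R) (Q : state R -> Prop) :
  (forall st', frame [:: 1] st st' ->
     outputs st' (O (query_set E (nats st q))) -> Q st') ->
  run O T (Query q 1) st T Q.
Proof.
move=> HQ; eexists; exists T; split=> //; first exact: exec_query.
apply: HQ => [|i lti].
  by split=> // a; rewrite inE /= /write_seq => /negbTE -> j.
(* The two sides differ in the default value of [nth], which does not matter below the size of the
   answer. *)
by rewrite /= /write_seq eqxx; apply: set_nth_default.
Qed.

Local Notation rk e := (nat_of_ord (enum_rank e)).

Lemma rank_eq (E : finType) (e f : E) : (rk e == rk f) = (e == f).
Proof. by rewrite val_eqE (inj_eq enum_rank_inj). Qed.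

Lemma rank_onto (E : finType) (i : nat) : i < #|E| -> exists e : E, i = rk e.
Proof. by move=> lti; exists (enum_val (Ordinal lti)); rewrite enum_valK. Qed.

Lemma outputs_nth (R : realType) (E : finType) (st : state R) (s : seq E)
    (j : nat) :
  outputs st (Some s) -> uniq s -> j < size s ->
  exists x, [/\ x \in s, index x s = j & nats st 1 j.+1 = rk x].
Proof.
move=> out us ltj; have x0 : E by case: s ltj {out us} => [|x].
exists (nth x0 s j); split; [exact: mem_nth|exact: index_uniq|].
by rewrite out /= ?size_map // (nth_map x0).
Qed.

Lemma outputs_size (R : realType) (E : finType) (st : state R) (s : seq E) :
  outputs st (Some s) -> nats st 1 0 = (size s).+1.
Proof. by move=> ->. Qed.

Lemma outputs_frame (R : realType) (E : finType) (l : seq nat)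
    (st st' : state R) (o : option (seq E)) :
  frame l st st' -> 1 \notin l -> outputs st o -> outputs st' o.
Proof. by move=> [fn _] l1 out i lti; rewrite fn // out. Qed.

(** * Subroutines and their specifications *)

(* Array names. For an element [e] of rank [r], cell [r] of
   - [aQRY] is 0 iff [e] is on the frontier (while the packing is built),
   - [aLO], [aHI] is the round in which [e] entered, left the frontier, or 0,
   - [aROW] is the address in [aPRE] of the row for the prefix of [e],
   - [rD] is the value of [rTAU] at which [e] is due to leave the frontier.
   [aCUR] is the first free address of [aPRE], [aK] the number of rounds and
   [rTAU] the total weight of the cuts so far. [aFND] holds the result of a
   search: a position of the answer in [find_last], and otherwise the rank of an
   element plus one, or 0 if there is none. *)
Local Notation aN := 0 (only parsing).
Local Notation aANS := 1 (only parsing).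
Local Notation aQRY := 2 (only parsing).
Local Notation aLO := 3 (only parsing).
Local Notation aHI := 4 (only parsing).
Local Notation aROW := 5 (only parsing).
Local Notation aPRE := 6 (only parsing).
Local Notation aCUR := 7 (only parsing).
Local Notation aK := 8 (only parsing).
Local Notation aV := 9 (only parsing).
Local Notation aJ := 10 (only parsing).
Local Notation aDONE := 11 (only parsing).
Local Notation aFND := 12 (only parsing).
Local Notation rD := 1 (only parsing).
Local Notation rTAU := 2 (only parsing).
Local Notation rGAMMA := 0 (only parsing).

(** An answer starts with its length plus one, so that [0] can mean that there is no path; the
    elements follow from cell 1 on. *)
Definition answer_at (j : nexp) : nexp := NGet aANS (NAdd j (NConst 1)).
Definition answer_size : nexp := NSub (NGet aANS (NConst 0)) (NConst 1).
Definition found : nexp := NSub (cell0 aFND) (NConst 1).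

(** The first query is all of [E], the complement of the empty frontier. *)
Definition init_query : cmd :=
  for_loop aJ (cell0 aN) (NSet aQRY (cell0 aJ) (NConst 1)).

Lemma init_query_spec (R : realType) (E : finType)
    (O : {set E} -> option (seq E)) (T : nat) (st : state R) :
  nats st aN 0 = #|E| ->
  run O T init_query st (#|E| * 3 + 2) (fun st' =>
    frame [:: aJ; aQRY] st st' /\ forall e : E, nats st' aQRY (rk e) = 1).
Proof.
move=> n_def.
apply: (@run_for _ _ _ _ _ _ _ _ _ _ (fun i st' =>
  frame [:: aJ; aQRY] st st' /\
  forall e : E, rk e < i -> nats st' aQRY (rk e) = 1)).
- by move=> i st' [[fn _] _]; rewrite /= fn.
- by split=> //; exact: frame_set.
- move=> i st' lti ji [fr H]; apply: run_nset => //=; split=> //.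
  split; first by do 2 apply: frame_set => //.
  move=> e; rewrite ltnS /update /= ji; case: eqP => // /eqP ne le.
  by apply: H; rewrite ltn_neqAle ne.
- by move=> st' [fr H]; split=> // e; apply: H.
Qed.

(** The test on [aFND] makes the first frontier element a candidate without comparison: as long as
    there is none, [found] truncates to 0 and names no candidate. *)
Definition find_min : cmd :=
  Seq (NSet aFND (NConst 0) (NConst 0))
    (for_loop aJ (cell0 aN)
       (If (BAnd (NLe (NGet aQRY (cell0 aJ)) (NConst 0))
              (BNot (BAnd (NLe (NConst 1) (cell0 aFND))
                       (RLe (RGet rD found) (RGet rD (cell0 aJ))))))
          (NSet aFND (NConst 0) (NAdd (cell0 aJ) (NConst 1)))
          Skip)).

Lemma find_min_spec (R : realType) (E : finType)
    (O : {set E} -> option (seq E)) (T : nat) (st : state R) :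
  nats st aN 0 = #|E| ->
  run O T find_min st (#|E| * 4 + 3) (fun st' =>
    frame [:: aJ; aFND] st st' /\
    ((nats st' aFND 0 = 0 /\ forall e : E, nats st aQRY (rk e) != 0) \/
     exists m : E, [/\ nats st' aFND 0 = (rk m).+1, nats st aQRY (rk m) = 0 &
       forall e : E, nats st aQRY (rk e) = 0 ->
         (rls st rD (rk m) <= rls st rD (rk e))%R])).
Proof.
move=> n_def; apply: (@run_seq _ _ _ _ _ _ _ 1 (#|E| * 4 + 2)); last by lia.
apply: run_nset => //=.
apply: (@run_for _ _ _ _ _ _ _ _ _ _ (fun i st' =>
  frame [:: aJ; aFND] st st' /\
    ((nats st' aFND 0 = 0 /\
      forall e : E, rk e < i -> nats st aQRY (rk e) != 0) \/
     exists m : E, [/\ nats st' aFND 0 = (rk m).+1, nats st aQRY (rk m) = 0 &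
       forall e : E, rk e < i -> nats st aQRY (rk e) = 0 ->
         (rls st rD (rk m) <= rls st rD (rk e))%R]))).
- by move=> i st' [[fn _] _]; rewrite /= fn.
- split; last by left; split.
  by do 2 apply: frame_set => //.
- move=> i st' lti ji [fr H]; have [x ix] := rank_onto lti.
  have lt_split (e : E) : rk e < i.+1 -> e = x \/ rk e < i.
    rewrite ltnS leq_eqVlt ix rank_eq => /orP[/eqP|]; by [left|right].
  apply: run_if => /=; rewrite ji (fr.1 aQRY isT) fr.2 leqn0.
  case: ifP => [/andP[qx0 cmp]|nq].
    apply: run_nset => //=; rewrite ji; split=> //.
    split; first by do 2 apply: frame_set => //.
    right; exists x; rewrite /update /= addn1 -ix; split=> //; first exact/eqP.
    move=> e /lt_split[->|lte] qe; first by rewrite ix.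
    case: H => [[_ /(_ e lte)]|[m [fm qm minm]]]; first by rewrite qe.
    move: cmp; rewrite fm subn1 /= -ltNge => /ltW xm.
    exact: le_trans xm (minm e lte qe).
  apply: run_skip => //; split=> //; split; first exact: frame_set.
  case: H => [[f0 Hf]|[m [fm qm minm]]].
    left; split=> // e /lt_split[->|]; last exact: Hf.
    by move: nq; rewrite f0 /= andbT ix => ->.
  right; exists m; split=> // e /lt_split[->|]; last exact: minm.
  rewrite -ix => qi; move: nq; rewrite qi fm subn1 /= => /negbFE.
  by [].
- move=> st' [fr [[f0 H]|[m [fm qm minm]]]]; split=> //.
    by left; split=> // e; apply: H.
  by right; exists m; split=> // e; apply: minm.
Qed.

(** One pass searches and stores: elements are marked in the free row until one with [aHI] equal to
    0 appears. The row starts out as zeros, so only ones have to be written. *)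
Definition find_entering : cmd :=
  Seq (NSet aFND (NConst 0) (NConst 0))
    (for_loop aJ answer_size
       (If (NLe (cell0 aFND) (NConst 0))
          (Seq (NSet aPRE (NAdd (cell0 aCUR) (answer_at (cell0 aJ)))
                  (NConst 1))
             (If (NLe (NGet aHI (answer_at (cell0 aJ))) (NConst 0))
                (NSet aFND (NConst 0)
                   (NAdd (answer_at (cell0 aJ)) (NConst 1)))
                Skip))
          Skip)).

Lemma find_entering_spec (R : realType) (E : finType)
    (O : {set E} -> option (seq E)) (T : nat) (st : state R) (s : seq E) :
  outputs st (Some s) -> uniq s ->
  (forall x, nats st aCUR 0 <= x -> nats st aPRE x = 0) ->
  run O T find_entering st (size s * 6 + 3) (fun st' =>
    [/\ frame [:: aJ; aFND; aPRE] st st',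
        forall x, x < nats st aCUR 0 -> nats st' aPRE x = nats st aPRE x,
        forall x, nats st aCUR 0 + #|E| <= x -> nats st' aPRE x = 0 &
    (nats st' aFND 0 = 0 /\ {in s, forall x, nats st aHI (rk x) != 0}) \/
    exists e : E, [/\ nats st' aFND 0 = (rk e).+1, e \in s,
       nats st aHI (rk e) = 0,
       {in s, forall x, index x s < index e s -> nats st aHI (rk x) != 0} &
       forall x, (nats st' aPRE (nats st aCUR 0 + rk x) != 0) =
         (x \in s) && (index x s <= index e s)]]).
Proof.
move=> out us pre0; set cur := nats st aCUR 0.
apply: (@run_seq _ _ _ _ _ _ _ 1 (size s * 6 + 2)); last by lia.
apply: run_nset => //=.
apply: (@run_for _ _ _ _ _ _ _ _ _ _ (fun i st' =>
    [/\ frame [:: aJ; aFND; aPRE] st st',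
        forall x, x < cur -> nats st' aPRE x = nats st aPRE x,
        forall x, cur + #|E| <= x -> nats st' aPRE x = 0 &
    [/\ nats st' aFND 0 = 0,
       {in s, forall x, index x s < i -> nats st aHI (rk x) != 0} &
       forall x, (nats st' aPRE (cur + rk x) != 0) =
         (x \in s) && (index x s < i)] \/
    exists e : E, [/\ nats st' aFND 0 = (rk e).+1, e \in s,
       nats st aHI (rk e) = 0,
       {in s, forall x, index x s < index e s -> nats st aHI (rk x) != 0} &
       forall x, (nats st' aPRE (cur + rk x) != 0) =
         (x \in s) && (index x s <= index e s)]])).
- by move=> i st' [[fn _] _ _ _]; rewrite /= fn // (outputs_size out) subn1.
- split=> //.
  + by do 2 apply: frame_set => //.
  + by move=> x lex; apply: pre0; apply: leq_trans lex; apply: leq_addr.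
  + by left; split=> [//|x _ //|x]; rewrite /= /update /= pre0 ?leq_addr // andbF.
- move=> i st' lti ji [fr below above H].
  have [x [xs xi ansx]] := outputs_nth out us lti.
  have lt_split y : y \in s -> index y s <= i -> y = x \/ index y s < i.
    move=> ys; rewrite leq_eqVlt => /orP[/eqP yi|]; [left|by right].
    by rewrite -(nth_index x ys) yi -xi nth_index.
  apply: run_if => /=.
  case: H => [[f0 Hhi Hpre]|[e [fe es e0 Hbef Hpre]]]; last first.
    rewrite fe /=; apply: run_skip => //; split=> //; split=> //.
      exact: frame_set.
    by right; exists e.
  rewrite f0 /=; apply: (@run_seq _ _ _ _ _ _ _ 1 2) => //.
  apply: run_nset => //=; rewrite ji (fr.1 aANS isT) (fr.1 aCUR isT) addn1 ansx.
  rewrite -/cur.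
  set st1 := set_nat st' _ _ _.
  have below1 y : y < cur -> nats st1 aPRE y = nats st aPRE y.
    move=> lty; rewrite /= /update /= ifN ?below //.
    by apply/negP => /eqP eqy; rewrite eqy ltnNge leq_addr in lty.
  have above1 y : cur + #|E| <= y -> nats st1 aPRE y = 0.
    move=> ley; rewrite /= /update /= ifN ?above //.
    apply/negP => /eqP eqy; rewrite eqy leq_add2l leqNgt in ley.
    by rewrite ltn_ord in ley.
  have pre1 y : (nats st1 aPRE (cur + rk y) != 0) =
      (y \in s) && (index y s <= i).
    rewrite /= /update /= eqn_add2l rank_eq; case: (y =P x) => [->|nyx].
      by rewrite xs xi leqnn.
    rewrite Hpre; apply: andb_id2l => ys; apply/idP/idP => [/ltnW//|].
    by move=> /(lt_split y ys)[].
  apply: run_if => /=; rewrite /update /= ji (fr.1 aANS isT) addn1 ansx.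
  rewrite (fr.1 aHI isT) leqn0.
  case: ifP => hx.
    have fnd1 : neval st1 (NAdd (answer_at (cell0 aJ)) (NConst 1)) = (rk x).+1.
      by rewrite /= /update /= ji (fr.1 aANS isT) !addn1 ansx.
    apply: run_nset => //; rewrite fnd1; split=> //.
    split=> //; first by do 3 apply: frame_set => //.
    by right; exists x; rewrite xi; split=> //; exact/eqP.
  apply: run_skip => //; split=> //; split=> //.
    by do 2 apply: frame_set => //.
  left; split=> // y ys; rewrite ltnS => /(lt_split y ys)[->|]; first by rewrite hx.
  exact: Hhi.
- move=> st' [fr below above [[f0 Hhi _]|H]]; split=> //.
    by left; split=> // x xs; apply: Hhi; rewrite ?index_mem.
  by right.
Qed.

(** [aV] counts up, hence the cut treated is number [aK - aV]. Later hits overwrite earlier ones,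
    and any old value of [aFND] is overwritten because every path meets the cut. *)
Definition find_last : cmd :=
  for_loop aJ answer_size
    (If (BAnd (NLe (NGet aLO (answer_at (cell0 aJ)))
                 (NSub (cell0 aK) (cell0 aV)))
           (NLe (NSub (cell0 aK) (cell0 aV))
              (NGet aHI (answer_at (cell0 aJ)))))
       (NSet aFND (NConst 0) (cell0 aJ))
       Skip).

Lemma find_last_spec (R : realType) (E : finType)
    (O : {set E} -> option (seq E)) (T : nat) (st : state R) (s : seq E) :
  let test x := nats st aLO (rk x) <= nats st aK 0 - nats st aV 0 <=
                nats st aHI (rk x) in
  outputs st (Some s) -> uniq s -> (exists2 x, x \in s & test x) ->
  run O T find_last st (size s * 4 + 2) (fun st' =>
    frame [:: aJ; aFND] st st' /\
    exists e, [/\ e \in s, nats st' aFND 0 = index e s, test e &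
      {in s, forall x, test x -> index x s <= index e s}]).
Proof.
move=> test out us ex_test.
apply: (@run_for _ _ _ _ _ _ _ _ _ _ (fun i st' =>
    frame [:: aJ; aFND] st st' /\
    ({in s, forall x, index x s < i -> ~~ test x} \/
    exists e, [/\ e \in s, nats st' aFND 0 = index e s, test e &
      {in s, forall x, index x s < i -> test x -> index x s <= index e s}]))).
- by move=> i st' [[fn _] _]; rewrite /= fn // (outputs_size out) subn1.
- by split; [exact: frame_set|left].
- move=> i st' lti ji [fr H].
  have [x [xs xi ansx]] := outputs_nth out us lti.
  have lt_split y : y \in s -> index y s <= i -> y = x \/ index y s < i.
    move=> ys; rewrite leq_eqVlt => /orP[/eqP yi|]; [left|by right].
    by rewrite -(nth_index x ys) yi -xi nth_index.
  apply: run_if => /=; rewrite ji !fr.1 // addn1 ansx -/(test x).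
  case: ifP => tx.
    apply: run_nset => //=; rewrite ji; split=> //.
    split; first by do 2 apply: frame_set => //.
    by right; exists x; rewrite xi; split=> // y _; rewrite ltnS.
  apply: run_skip => //; split=> //; split; first exact: frame_set.
  case: H => [H|[e [es fe te H]]]; [left|right].
    by move=> y ys; rewrite ltnS => /(lt_split y ys)[->|]; [rewrite tx|apply: H].
  exists e; split=> // y ys; rewrite ltnS => /(lt_split y ys)[->|]; last exact: H.
  by rewrite tx.
- move=> st' [fr [H|[e [es fe te H]]]]; split=> //.
    have [x xs tx] := ex_test.
    by have := H x xs; rewrite index_mem => /(_ xs); rewrite tx.
  by exists e; split=> // x xs tx; apply: H; rewrite ?index_mem.
Qed.

(** Together with [mark_suffix] this prepares the rerouting query. All of [aQRY] is overwritten, so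
    nothing of the previous query survives. *)
Definition copy_prefix : cmd :=
  for_loop aJ (cell0 aN)
    (NSet aQRY (cell0 aJ)
       (NGet aPRE (NAdd (NGet aROW (answer_at (cell0 aFND))) (cell0 aJ)))).

Lemma copy_prefix_spec (R : realType) (E : finType)
    (O : {set E} -> option (seq E)) (T : nat) (st : state R) :
  nats st aN 0 = #|E| ->
  run O T copy_prefix st (#|E| * 3 + 2) (fun st' =>
    frame [:: aJ; aQRY] st st' /\ forall x : E, nats st' aQRY (rk x) =
      nats st aPRE (nats st aROW (nats st aANS (nats st aFND 0).+1) + rk x)).
Proof.
move=> n_def.
apply: (@run_for _ _ _ _ _ _ _ _ _ _ (fun i st' =>
  frame [:: aJ; aQRY] st st' /\
  forall x : E, rk x < i -> nats st' aQRY (rk x) =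
      nats st aPRE (nats st aROW (nats st aANS (nats st aFND 0).+1) + rk x))).
- by move=> i st' [[fn _] _]; rewrite /= fn.
- by split=> //; exact: frame_set.
- move=> i st' lti ji [fr H].
  apply: run_nset => //=; rewrite ji !fr.1 // addn1; split=> //.
  split; first by do 2 apply: frame_set => //.
  move=> e; rewrite ltnS /update /=.
  case: eqP => [-> //|/eqP ne le].
  by apply: H; rewrite ltn_neqAle ne.
- by move=> st' [fr H]; split=> // e; apply: H.
Qed.

Definition mark_suffix : cmd :=
  for_loop aJ answer_size
    (If (NLe (cell0 aFND) (cell0 aJ))
       (NSet aQRY (answer_at (cell0 aJ)) (NConst 1))
       Skip).

Lemma mark_suffix_spec (R : realType) (E : finType)
    (O : {set E} -> option (seq E)) (T : nat) (st : state R) (s : seq E) :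
  outputs st (Some s) -> uniq s ->
  run O T mark_suffix st (size s * 4 + 2) (fun st' =>
    frame [:: aJ; aQRY] st st' /\
    forall x : E, (nats st' aQRY (rk x) != 0) = (nats st aQRY (rk x) != 0) ||
      (x \in s) && (nats st aFND 0 <= index x s)).
Proof.
move=> out us.
apply: (@run_for _ _ _ _ _ _ _ _ _ _ (fun i st' =>
  frame [:: aJ; aQRY] st st' /\
    forall x : E, (nats st' aQRY (rk x) != 0) = (nats st aQRY (rk x) != 0) ||
      [&& x \in s, nats st aFND 0 <= index x s & index x s < i])).
- by move=> i st' [[fn _] _]; rewrite /= fn // (outputs_size out) subn1.
- split; first exact: frame_set.
  by move=> x; rewrite !andbF orbF.
- move=> i st' lti ji [fr H].
  have [x [xs xi ansx]] := outputs_nth out us lti.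
  have lt_split y : y \in s -> y != x -> (index y s < i.+1) = (index y s < i).
    move=> ys nyx; rewrite ltnS leq_eqVlt; case: eqP => // yi.
    by rewrite -(nth_index x ys) yi -xi nth_index // eqxx in nyx.
  apply: run_if => /=; rewrite ji (fr.1 aFND isT).
  case: ifP => le_f.
    apply: run_nset => //=; rewrite ji (fr.1 aANS isT) addn1 ansx; split=> //.
    split; first by do 2 apply: frame_set => //.
    move=> y; rewrite /= /update /= rank_eq; case: (y =P x) => [->|/eqP nyx].
      by rewrite xs xi le_f ltnSn !orbT.
    by rewrite H; congr orb; apply: andb_id2l => ys; rewrite lt_split.
  apply: run_skip => //; split=> //; split; first exact: frame_set.
  move=> y; rewrite /= /update /= H; congr orb; apply: andb_id2l => ys.
  have [->|nyx] := eqVneq y x; last by rewrite lt_split.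
  by rewrite xi le_f.
- move=> st' [fr H]; split=> // x; rewrite H; congr orb.
  by apply: andb_id2l => xs; rewrite index_mem xs andbT.
Qed.

(** * The program *)

Definition pop : cmd :=
  Seq (NSet aHI found (NAdd (cell0 aK) (NConst 1)))
    (Seq (NSet aQRY found (NConst 1))
       (Seq (RSet rTAU (NConst 0) (RGet rD found))
          (NSet aK (NConst 0) (NAdd (cell0 aK) (NConst 1))))).

Definition enter : cmd :=
  Seq (NSet aLO found (NAdd (cell0 aK) (NConst 1)))
    (Seq (NSet aQRY found (NConst 0))
       (Seq (RSet rD found (RAdd (RGet rTAU (NConst 0)) (RGet rGAMMA found)))
          (Seq (NSet aROW found (cell0 aCUR))
             (NSet aCUR (NConst 0) (NAdd (cell0 aCUR) (cell0 aN)))))).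

Definition stop : cmd := NSet aDONE (NConst 0) (NConst 1).

Definition packing_step : cmd :=
  Seq (Query aQRY aANS)
    (If (NLe (NGet aANS (NConst 0)) (NConst 0))
       (Seq find_min (If (NLe (cell0 aFND) (NConst 0)) stop pop))
       (Seq find_entering (If (NLe (cell0 aFND) (NConst 0)) stop enter))).

(** Every round before [stop] makes an element enter or leave the frontier, which can happen [2 |E|]
    times in all. After [stop] the rounds are idle, so the final answer stays in [aANS]. *)
Definition packing_loop : cmd :=
  for_loop aV (NAdd (NAdd (cell0 aN) (cell0 aN)) (NConst 1))
    (If (NLe (cell0 aDONE) (NConst 0)) packing_step Skip).

Definition rerouting_loop : cmd :=
  for_loop aV (cell0 aK)
    (Seq find_last (Seq copy_prefix (Seq mark_suffix (Query aQRY aANS)))).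

(** Answers arrive in the output array, so the last one is the output. A leading [0] already reports
    that there is no path. *)
Definition min_path_program : cmd :=
  Seq init_query
    (Seq packing_loop
       (If (NLe (NConst 1) (NGet aANS (NConst 0))) rerouting_loop Skip)).

(** * The packing phase *)

(* The prefix [A e] is stored as a row of [#|E|] cells of [aPRE], which starts at
   the cell [aROW] of [e]; rows are allocated consecutively from [aCUR]. *)
Definition represents (R : realType) (E : finType) (gamma : E -> R)
    (lo hi : E -> nat) (A : E -> {set E}) (D : E -> R) (K : nat) (tau : R)
    (st : state R) : Prop :=
  [/\ [/\ nats st aN 0 = #|E|, nats st aK 0 = K & rls st rTAU 0 = tau],
      [/\ forall e, nats st aLO (rk e) = lo e,
          forall e, nats st aHI (rk e) = hi e,
          forall e, rls st rGAMMA (rk e) = gamma e &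
          forall e, rls st rD (rk e) = D e],
      forall e, 0 < lo e -> nats st aROW (rk e) + #|E| <= nats st aCUR 0 &
      forall e f, 0 < lo e ->
        (nats st aPRE (nats st aROW (rk e) + rk f) != 0) = (f \in A e)].

Lemma represents_frame (R : realType) (E : finType) (gamma : E -> R)
    (lo hi : E -> nat) (A : E -> {set E}) (D : E -> R) (K : nat) (tau : R)
    (l : seq nat) (st st' : state R) :
  frame l st st' ->
  all (fun a => a \notin l) [:: aN; aLO; aHI; aROW; aPRE; aCUR; aK] ->
  represents gamma lo hi A D K tau st -> represents gamma lo hi A D K tau st'.
Proof.
move=> [fn fr] /and5P[l0 l3 l4 l5 /and4P[l6 l7 l8 _]].
rewrite /represents fr !fn //; case=> -[? ? ?] [Hlo Hhi ? ?] Hrow Hpre.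
split=> //.
- by split=> // e; rewrite fn.
- by move=> e le; rewrite fn // Hrow.
- by move=> e f le; rewrite !fn // Hpre.
Qed.

(** The bound on [i] is the termination argument: each unfinished round raises by one either the
    number of entered elements or the number [K] of those that left. *)
Definition packing_inv (R : realType) (E : finType) (N : abstract_network E)
    (gamma : E -> R) (i : nat) (st : state R) : Prop :=
  exists lo hi A D K tau eps,
  [/\ packing N gamma lo hi A D K tau eps,
      represents gamma lo hi A D K tau st &
      if nats st aDONE 0 == 0 then
        [/\ forall e, (nats st aQRY (rk e) == 0) = (0 < lo e) && (hi e == 0),
            forall x, nats st aCUR 0 <= x -> nats st aPRE x = 0 &
            i <= #|[set e | 0 < lo e]| + K]
      else exists2 o, outputs st o &
        if o is Some s then listed_path N s /\ {in s, forall x, 0 < hi x}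
        else paths N = set0].

Lemma listed_uniq (E : finType) (N : abstract_network E) (s : seq E) :
  listed_path N s -> uniq s.
Proof. by case=> P _ [[]]. Qed.

Lemma uniq_size (E : finType) (s : seq E) : uniq s -> size s <= #|E|.
Proof. by move=> us; rewrite -(card_uniqP us) max_card. Qed.

Lemma oracle_some (E : finType) (N : abstract_network E)
    (O : {set E} -> option (seq E)) (F : {set E}) (s : seq E) :
  membership_oracle N O -> O F = Some s ->
  listed_path N s /\ {subset s <= F}.
Proof.
move=> /(_ F) + eqO; rewrite eqO => -[P [PN /subsetP PF sP ss]].
split; first by exists P.
by move=> x; rewrite (proj2 sP) => /PF.
Qed.

Lemma oracle_none (E : finType) (N : abstract_network E)
    (O : {set E} -> option (seq E)) (F P : {set E}) :
  membership_oracle N O -> O F = None -> P \in paths N ->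
  exists2 x, x \in P & x \notin F.
Proof.
move=> /(_ F) + eqO; rewrite eqO => H /H /subsetPn.
by [].
Qed.

Lemma pop_spec (R : realType) (E : finType) (N : abstract_network E)
    (O : {set E} -> option (seq E)) (T : nat) (gamma : E -> R) (i : nat)
    (lo hi : E -> nat) (A : E -> {set E}) (D : E -> R) (K : nat) (tau : R)
    (eps : nat -> R) (st : state R) (m : E) :
  packing N gamma lo hi A D K tau eps ->
  represents gamma lo hi A D K tau st ->
  nats st aDONE 0 = 0 ->
  (forall e, (nats st aQRY (rk e) == 0) = (0 < lo e) && (hi e == 0)) ->
  (forall x, nats st aCUR 0 <= x -> nats st aPRE x = 0) ->
  i <= #|[set e | 0 < lo e]| + K ->
  (forall P, P \in paths N -> exists2 e, e \in P & (0 < lo e) && (hi e == 0)) ->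
  nats st aFND 0 = (rk m).+1 -> 0 < lo m -> hi m = 0 ->
  (forall e, 0 < lo e -> hi e = 0 -> (D m <= D e)%R) ->
  run O T pop st 4 (fun st' =>
    nats st' aV 0 = nats st aV 0 /\ packing_inv N gamma i.+1 st').
Proof.
move=> pk [[Hn HK Htau] [Hlo Hhi Hg HD] Hrow Hpre] Hdone Hq Hpre0 Hi Hcut Hf lom him Hmin.
have fE : nats st aFND 0 - 1 = rk m by rewrite Hf subn1.
do 3 (apply: (@run_seq _ _ _ _ _ _ _ 1 _ _ _ _ (leqnn _));
  (apply: run_nset || apply: run_rset) => //=; rewrite /= /update /= ?fE).
apply: run_nset => //=; rewrite /= /update /= ?fE HK addn1; split=> //.
have [eps' pk'] := packing_pop pk Hcut lom him Hmin.
exists lo, (upd hi m K.+1), A, D, K.+1, (D m), eps'; split=> //.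
  split=> //=.
  by split=> // e; rewrite /update /= rank_eq /upd -Hhi.
rewrite /= /update /= Hdone /=; split=> //.
  move=> e; rewrite rank_eq /upd; case: (e =P m) => [->|_]; last exact: Hq.
  by rewrite andbF.
by rewrite addnS ltnS.
Qed.

Lemma enter_spec (R : realType) (E : finType) (N : abstract_network E)
    (O : {set E} -> option (seq E)) (T : nat) (gamma : E -> R) (i : nat)
    (lo hi : E -> nat) (A : E -> {set E}) (D : E -> R) (K : nat) (tau : R)
    (eps : nat -> R) (st : state R) (s : seq E) (e : E) :
  (forall e, 0 <= gamma e)%R ->
  packing N gamma lo hi A D K tau eps ->
  represents gamma lo hi A D K tau st ->
  nats st aDONE 0 = 0 ->
  (forall x, (nats st aQRY (rk x) == 0) = (0 < lo x) && (hi x == 0)) ->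
  (forall x, nats st aCUR 0 + #|E| <= x -> nats st aPRE x = 0) ->
  i <= #|[set e | 0 < lo e]| + K ->
  listed_path N s -> e \in s -> nats st aFND 0 = (rk e).+1 ->
  lo e = 0 -> hi e = 0 ->
  (forall x, x \in s -> index x s < index e s -> 0 < hi x) ->
  (forall x, (nats st aPRE (nats st aCUR 0 + rk x) != 0) =
     (x \in s) && (index x s <= index e s)) ->
  run O T enter st 5 (fun st' =>
    nats st' aV 0 = nats st aV 0 /\ packing_inv N gamma i.+1 st').
Proof.
move=> gamma0 pk [[Hn HK Htau] [Hlo Hhi Hg HD] Hrow Hpre] Hdone Hq Hpre0 Hi ls es Hf
  loe hie Hbef Hrowe.
have fE : nats st aFND 0 - 1 = rk e by rewrite Hf subn1.
do 4 (apply: (@run_seq _ _ _ _ _ _ _ 1 _ _ _ _ (leqnn _));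
  (apply: run_nset || apply: run_rset) => //=; rewrite /= /update /= ?fE).
apply: run_nset => //=; rewrite /= /update /= ?fE HK Htau Hg Hn addn1; split=> //.
pose B := [set x | (x \in s) && (index x s <= index e s)].
have BE x : (x \in B) = (x \in s) && (index x s <= index e s) by rewrite inE.
have pk' := packing_enter gamma0 pk ls es loe hie Hbef BE.
exists (upd lo e K.+1), hi, (upd A e B), (upd D e (tau + gamma e)%R), K, tau, eps.
split=> //.
  split=> //=.
  - by split=> // x; rewrite /update /= ?rank_eq /upd -?Hlo -?HD.
  - move=> x; rewrite /update /= rank_eq /upd; case: (x =P e) => // _ /Hrow lex.
    exact: leq_trans lex (leq_addr _ _).
  - move=> x f; rewrite /update /= rank_eq /upd; case: (x =P e) => [_ _|_].
      by rewrite Hrowe BE.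
    exact: Hpre.
rewrite /= /update /= Hdone /=; split=> //.
  move=> x; rewrite rank_eq /upd; case: (x =P e) => [->|_]; last exact: Hq.
  by rewrite hie.
rewrite (_ : [set _ | _] = e |: [set x | 0 < lo x]).
  by rewrite cardsU1 inE loe /= add1n addSn ltnS.
by apply/setP => x; rewrite !inE /upd; case: (x =P e).
Qed.

Lemma packing_step_spec (R : realType) (E : finType) (N : abstract_network E)
    (O : {set E} -> option (seq E)) (T : nat) (gamma : E -> R) (i : nat)
    (st : state R) :
  membership_oracle N O -> (forall e, 0 <= gamma e)%R ->
  packing_inv N gamma i st -> nats st aDONE 0 = 0 ->
  run O T packing_step st (T + (#|E| * 6 + 10)) (fun st' =>
    nats st' aV 0 = nats st aV 0 /\ packing_inv N gamma i.+1 st').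
Proof.
move=> HO gamma0 [lo [hi [A [D [K [tau [eps [pk rep]]]]]]]] + Hdone.
rewrite Hdone eqxx => -[Hq Hpre0 Hi].
apply: run_seq (leqnn _); apply: run_query => st1 fr1 out1.
have rep1 := represents_frame fr1 isT rep.
have [[Hn1 _ _] [Hlo1 Hhi1 _ HD1] _ _] := rep1.
have qE (x : E) : (x \in query_set E (nats st aQRY)) = ~~ ((0 < lo x) && (hi x == 0)).
  by rewrite inE -Hq.
rewrite addnS; apply: run_if; rewrite [beval _ _]/=.
case eqO: (O _) out1 => [s|] out1.
  have [ls sF] := oracle_some HO eqO; have us := listed_uniq ls.
  rewrite (outputs_size out1) /=.
  apply: (@run_seq _ _ _ _ _ _ _ (size s * 6 + 3) 6); last first.
    by rewrite -addnA leq_add2r leq_mul2r uniq_size.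
  apply: (run_mono (find_entering_spec O T out1 us _)) => //.
    by move=> x; rewrite !fr1.1 //; apply: Hpre0.
  move=> st2 [fr2 below2 above2 H2].
  apply: run_if => /=.
  case: H2 => [[-> Hs]|[e [fe es he Hbef Hrow]]].
    apply: run_nset => //=; split; first by rewrite /update /= fr2.1 ?fr1.1.
    exists lo, hi, A, D, K, tau, eps; split=> //; last first.
      rewrite /= /update /=; exists (Some s).
        exact: (outputs_frame fr2 isT out1).
      by split=> // x /Hs; rewrite Hhi1 lt0n.
    (* The failed search has left marks in [aPRE], so [represents_frame] does not apply; but the
       stored rows lie below [aCUR], where nothing changed. *)
    have [[nE KE tE] [loE hiE gE DE] rowE preE] := rep1.
    have [fn2 r2] := fr2.
    split=> /=; rewrite /update /= ?fn2 ?r2 //.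
    - by split=> // x; rewrite fn2.
    - by move=> x lx; rewrite !fn2 // rowE.
    - move=> x f lx; rewrite (fn2 aROW) // below2 ?preE //.
      by apply: leq_trans (rowE x lx); rewrite ltn_add2l.
  rewrite fe /=.
  have hie : hi e = 0 by rewrite -Hhi1.
  (* The query avoids the frontier, so an element of the answer that has not left has not entered
     either. *)
  have loe : lo e = 0.
    by move: (sF e es); rewrite qE hie andbT -eqn0Ngt => /eqP.
  have fr12 := frame_trans fr1 fr2.
  have [[nE KE tE] [loE hiE gE DE] rowE preE] := rep1.
  have [fn2 r2] := fr2.
  apply: (run_mono (enter_spec (i := i) O T gamma0 pk _ _ _ _ _ ls es fe loe hie _ _)) => //.
  - split=> /=; rewrite ?fn2 ?r2 //.
    + by split=> // x; rewrite fn2.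
    + by move=> x lx; rewrite !fn2 // rowE.
    + move=> x f lx; rewrite (fn2 aROW) // below2 ?preE //.
      by apply: leq_trans (rowE x lx); rewrite ltn_add2l.
  - by rewrite fr12.1 // Hdone.
  - by move=> x; rewrite fr12.1.
  - by move=> x; rewrite fn2 //; apply: above2.
  - by move=> x xs ltx; rewrite lt0n -Hhi1; apply: Hbef.
  - by move=> x; rewrite (fn2 aCUR).
  - by move=> st' [-> inv]; split=> //; rewrite fr12.1.
rewrite out1 // [0 <= 0]/=.
apply: (@run_seq _ _ _ _ _ _ _ (#|E| * 4 + 3) 5); last by lia.
apply: (run_mono (find_min_spec O T Hn1)) => // st2 [fr2 H2].
have fr12 := frame_trans fr1 fr2.
have rep2 := represents_frame fr2 isT rep1.
apply: run_if => /=.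
case: H2 => [[-> Hall]|[m [fm qm minm]]].
  apply: run_nset => //=; split; first by rewrite /update /= fr12.1.
  exists lo, hi, A, D, K, tau, eps; split=> //.
  rewrite /= /update /=; exists None.
    exact: (outputs_frame fr2 isT out1).
  (* The frontier is empty here, so the query was all of [E]. *)
  apply/setP => P; rewrite inE; apply/negP => PN.
  have [x _ /negP[]] := oracle_none HO eqO PN.
  by rewrite inE; have := Hall x; rewrite fr1.1.
rewrite fm /=.
have Cm x : (nats st1 aQRY (rk x) == 0) = (0 < lo x) && (hi x == 0).
  by rewrite fr1.1.
have /andP[lom /eqP him] : (0 < lo m) && (hi m == 0) by rewrite -Cm qm.
apply: (run_mono (pop_spec (i := i) O T pk rep2 _ _ _ _ _ fm lom him _)) => //.
- by rewrite fr12.1 // Hdone.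
- by move=> x; rewrite fr12.1.
- by move=> x; rewrite !fr12.1 //; apply: Hpre0.
(* A negative answer means that every path meets the complement of the query, which is the
   frontier. *)
- move=> P PN; have [x xP xF] := oracle_none HO eqO PN; exists x => //.
  by move: xF; rewrite qE negbK.
- move=> x lx hx; rewrite -!HD1; apply: minm; apply/eqP; rewrite Cm lx hx //.
- by move=> st' [-> inv]; split=> //; rewrite fr12.1.
Qed.

Lemma packing_loop_spec (R : realType) (E : finType) (N : abstract_network E)
    (O : {set E} -> option (seq E)) (T : nat) (gamma : E -> R) (st : state R) :
  membership_oracle N O -> (forall e, 0 <= gamma e)%R ->
  packing_inv N gamma 0 st ->
  run O T packing_loop st
    ((#|E| + #|E| + 1) * (T + (#|E| * 6 + 10)).+3 + 2) (fun st' =>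
    packing_inv N gamma (#|E| + #|E| + 1) st' /\ nats st' aDONE 0 != 0).
Proof.
move=> HO gamma0 inv0.
apply: (run_for (I := packing_inv N gamma)) => //.
- move=> i st' [lo [hi [A [D [K [tau [eps [_ [[Hn _ _] _ _ _] _]]]]]]]].
  by rewrite /= Hn.
- move=> i st' lti vi inv; apply: run_if => /=; rewrite leqn0.
  case: eqP => [done0|/eqP done1].
    apply: (run_mono (packing_step_spec T HO gamma0 inv done0)) => // st2 [v2 inv2].
    by rewrite v2 vi; split.
  apply: run_skip; first by lia.
  split=> //; case: inv => lo [hi [A [D [K [tau [eps]]]]]].
  rewrite (negbTE done1) => -[pk rep H].
  exists lo, hi, A, D, K, tau, eps; split=> //.
  by rewrite /= /update /= (negbTE done1).
- move=> st' inv; split=> //; apply/negP => /eqP done0.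
  case: inv => lo [hi [A [D [K [tau [eps]]]]]]; rewrite done0 eqxx => -[pk _ [_ _]].
  rewrite (pack_card pk); apply/negP; rewrite -ltnNge addn1 ltnS.
  by apply: leq_add; apply: max_card.
Qed.

(** * The rerouting phase and the final bound *)

Lemma listed_mem (E : finType) (N : abstract_network E) (s : seq E) :
  listed_path N s -> exists2 P, P \in paths N & s =i P.
Proof. by case=> P PN [[_ sP] _]; exists P. Qed.

(** Every path meets every cut by [pack_cut], so only uniqueness is tracked, for the last [v]
    cuts. *)
Definition rerouting_inv (R : realType) (E : finType) (N : abstract_network E)
    (gamma : E -> R) (lo hi : E -> nat) (A : E -> {set E}) (D : E -> R)
    (K : nat) (tau : R) (v : nat) (st : state R) : Prop :=
  represents gamma lo hi A D K tau st /\
  exists s, [/\ outputs st (Some s), listed_path N s,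
    {in s, forall x, 0 < hi x} &
    forall j, K - v < j <= K -> {in s &, forall x y,
      in_cut lo hi j x -> in_cut lo hi j y -> x = y}].

Lemma rerouting_loop_spec (R : realType) (E : finType) (N : abstract_network E)
    (O : {set E} -> option (seq E)) (T : nat) (gamma : E -> R)
    (lo hi : E -> nat) (A : E -> {set E}) (D : E -> R) (K : nat) (tau : R)
    (eps : nat -> R) (st : state R) :
  membership_oracle N O -> packing N gamma lo hi A D K tau eps ->
  rerouting_inv N gamma lo hi A D K tau 0 st ->
  run O T rerouting_loop st (K * (#|E| * 11 + 6 + T).+2 + 2)
    (rerouting_inv N gamma lo hi A D K tau K).
Proof.
move=> HO pk inv0.
apply: (run_for (I := rerouting_inv N gamma lo hi A D K tau)) => //.
  by move=> i st' [[[_ HK _] _ _ _] _]; rewrite /= HK.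
move=> v st0 ltv vE [rep [s [out ls his uniqs]]].
have us := listed_uniq ls.
have [[Hn HK _] [Hlo Hhi _ _] _ Hpre] := rep.
have le_sn : size s * 4 <= #|E| * 4 by rewrite leq_mul2r uniq_size.
(* On [s] the value [hi x] is positive, so the zero case of [in_cut] drops out and the test of
   [find_last] is exact. *)
have cutE x : x \in s -> in_cut lo hi (K - v) x = (lo x <= K - v <= hi x).
  move=> xs; have hx := his x xs; rewrite /in_cut (pack_lohi pk hx).
  by rewrite [hi x == 0]eqn0Ngt hx.
apply: (@run_seq _ _ _ _ _ _ _ (#|E| * 4 + 2)
  (#|E| * 3 + 2 + (#|E| * 4 + 2 + T))); last by lia.
have testE x : (nats st0 aLO (rk x) <= nats st0 aK 0 - nats st0 aV 0 <=
    nats st0 aHI (rk x)) = (lo x <= K - v <= hi x).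
  by rewrite Hlo Hhi HK vE.
apply: (run_mono (find_last_spec O T out us _)).
- have [P PN sP] := listed_mem ls.
  have [|x xP xc] := pack_cut pk (i := K - v) _ PN.
    by rewrite subn_gt0 ltv leq_subr.
  rewrite -sP in xP.
  by exists x => //; rewrite testE -cutE.
- by rewrite leq_add2r.
move=> st1 [fr1 [e [es fe]]]; rewrite testE -cutE // => ec laste.
apply: run_seq (leqnn _).
apply: (run_mono (copy_prefix_spec O T _)) => //; first by rewrite fr1.1.
move=> st2 [fr2 q2].
have fr12 := frame_trans fr1 fr2.
have out2 := outputs_frame fr12 isT out.
apply: run_seq (leqnn _).
apply: (run_mono (mark_suffix_spec O T out2 us)); first by rewrite leq_add2r.
move=> st3 [fr3 q3]; have fr13 := frame_trans fr12 fr3.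
apply: run_query => st4 fr4 out4; have fr14 := frame_trans fr13 fr4.
have lo0 : 0 < lo e by case/and3P: ec.
have ans_e : nats st1 aANS (nats st1 aFND 0).+1 = rk e.
  have lte : index e s < size s by rewrite index_mem.
  have [x [xs xi xE]] := outputs_nth out us lte.
  by rewrite fe fr1.1 // xE -(nth_index e xs) xi nth_index.
have queryE x : (x \in query_set E (nats st3 aQRY)) =
    (x \in A e) || (x \in s) && (index e s <= index x s).
  rewrite inE q3 q2 ans_e (fr2.1 aFND) // fe; congr orb.
  by rewrite !fr1.1 // Hpre.
(* This path lies inside the query, so the oracle cannot answer [None]. *)
have [Q QN HQ] := pack_prefix pk lo0 ls es.
case eqO: (O _) out4 => [u|] out4; last first.
  by have [x /HQ xq /negP[]] := oracle_none HO eqO QN; rewrite queryE.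
have [lu uF] := oracle_some HO eqO.
split; first by rewrite fr14.1.
have rep4 : represents gamma lo hi A D K tau st4 := represents_frame fr14 isT rep.
have [hiu uniqu] : {in [set x in u], forall x, 0 < hi x} /\
  (forall j, K - v <= j <= K -> {in [set x in u] &, forall x y,
     in_cut lo hi j x -> in_cut lo hi j y -> x = y}).
  apply: (packing_reroute pk es ec his _ uniqs) => [x xs|x].
    by rewrite cutE // -testE; apply: laste.
  by rewrite inE => /uF; rewrite queryE.
split=> //; exists u; split=> //.
  by move=> x xu; apply: hiu; rewrite inE.
(* As [v < K], the bound [K - v.+1 < j] amounts to [K - v <= j]. *)
move=> j /andP[ltj leK] x y xu yu; apply: (uniqu j); rewrite ?inE // leK andbT.
by move: ltj ltv; clear; lia.
Qed.

Theorem theorem5 (R : realType) :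
  exists (prog : cmd) (C : nat),
    forall (E : finType) (N : abstract_network E)
      (O : {set E} -> option (seq E)) (T : nat) (gamma : E -> R),
      membership_oracle N O ->
      (0 < T)%N ->
      (forall e, (0 <= gamma e)%R) ->
      exists (st : state R) (t : nat) (o : option (seq E)),
        [/\ exec O T prog (initial_state gamma) st t,
            outputs st o,
            solves_min_path N gamma o
          & (0 < #|E|)%N -> (t <= C * #|E| ^ 2 * T)%N].
Proof.
(* The packing phase makes at most [2 n + 1] queries and the rerouting phase at most [n], each with
   [O(n)] further work, so the time is [O(n T + n^2)]; 200 is a generous constant. *)
exists min_path_program, 200 => E N O T gamma HO T0 gamma0.
set n := #|E|.
pose k2 := (n + n + 1) * (T + (n * 6 + 10)).+3 + 2.
pose k3 := (n * (n * 11 + 6 + T).+2 + 2).+1.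
suff [st [t [ex le_t [o out sol]]]] : run O T min_path_program
    (initial_state gamma) (n * 3 + 2 + (k2 + k3))
    (fun st => exists2 o, outputs st o & solves_min_path N gamma o).
  exists st, t, o; split=> // n0; apply: leq_trans le_t _.
  rewrite /k2 /k3 -mulnn; clearbody n; nia.
apply: run_seq (leqnn _).
apply: (run_mono (init_query_spec O T _)) => // st1 [fr1 q1].
apply: run_seq (leqnn _).
have inv1 : packing_inv N gamma 0 st1.
  exists (fun=> 0), (fun=> 0), (fun=> set0), (fun=> 0%R), 0, 0%R, (fun=> 0%R).
  split; first exact: packing0.
    have [fn fr] := fr1.
    split=> //; first by split; rewrite ?fn ?fr.
    split=> e; rewrite ?fn ?fr //=.
    have lte := ltn_ord (enum_rank e).
    by rewrite (nth_map e) -?cardE ?nth_enum_rank.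
  rewrite fr1.1 //=; split=> // [e|x _]; first by rewrite q1.
  by rewrite fr1.1.
apply: (run_mono (packing_loop_spec T HO gamma0 inv1)) => // st2 [inv2 done2].
case: inv2 => lo [hi [A [D [K [tau [eps]]]]]].
rewrite (negbTE done2) => -[pk rep [o out fin]].
apply: run_if => /=.
case: o out fin => [s|] out fin; last first.
  by rewrite out //=; apply: run_skip; [rewrite addn2|exists None].
rewrite (outputs_size out) /=; case: fin => ls his.
apply: (run_mono (rerouting_loop_spec T HO pk (st := st2) _)).
- split=> //; exists s; split=> // j; rewrite subn0 => /andP[ltj lej].
  by rewrite ltnNge lej in ltj.
- by rewrite leq_add2r leq_mul2r (pack_card pk) max_card orbT.
move=> st3 [_ [u [outu lu hiu uniqu]]]; exists (Some u) => //.
have [P PN [enP _]] := lu; exists P => //.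
have uP x : x \in P -> x \in u by rewrite (proj2 enP).
apply: (packing_optimal pk PN) => [x /uP/hiu//|j /andP[j0 jK] x y xP yP].
by apply: (uniqu j); rewrite ?uP // subnn j0.
Qed.
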